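(* Let $k=3$, $a=\frac34$, $b=\frac94$ and $\mu_1=\mu_2=\mu_3=\frac13$. Then the system $$\mu_i a x_i=\sum_{j\ne i}\frac{\mu_i\mu_j(x_i-x_j)}{r_{ij}^3},\qquad \mu_i b y_i=\sum_{j\ne i}\frac{\mu_i\mu_j(y_i-y_j)}{r_{ij}^3},\qquad i=1,2,3,$$ has exactly $24=4\cdot 3!$ solutions $(p_1,p_2,p_3)\in(\mathbb{R}^2)^3$ (bodies labelled), namely: - $3!$ solutions collinear on the $x$ axis; - $3!$ solutions collinear on the $y$ axis; - $2\cdot 3!$ solutions in which the bodies form an isosceles triangle symmetric with respect to the $x$ axis, or its reflection with respect to the $y$ axis.
   Context: Here $p_i=(x_i,y_i)\in\mathbb{R}^2$ are pairwise distinct and $r_{ij}=|p_i-p_j|$. *)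

(* Defs.v *)
From HB Require Import structures.
From mathcomp Require Import all_boot all_order all_algebra all_fingroup.
From mathcomp Require Import boolp classical_sets functions cardinality reals.

Set Implicit Arguments.
Unset Strict Implicit.
Unset Printing Implicit Defensive.

Import Order.TTheory GRing.Theory Num.Theory.

Local Open Scope classical_set_scope.
Local Open Scope ring_scope.

Section Configurations.
Variable R : realType.
Implicit Types (u v : R * R).

(* The norm that the library puts on [R * R] is the sup norm, hence the explicit
   Euclidean formula. *)
Definition dist u v : R :=
  Num.sqrt ((u.1 - v.1) ^+ 2 + (u.2 - v.2) ^+ 2).

Definition reflx u : R * R := (u.1, - u.2).

Definition refly u : R * R := (- u.1, u.2).

Section Bodies.
Variable k : nat.
Implicit Types (mu : 'I_k -> R) (p : 'I_k -> R * R).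

Definition solutions (a b : R) mu : set ('I_k -> R * R) :=
  [set p | injective p /\
    forall i : 'I_k,
      mu i * a * (p i).1 =
        \sum_(j < k | j != i)
          mu i * mu j * ((p i).1 - (p j).1) / dist (p i) (p j) ^+ 3 /\
      mu i * b * (p i).2 =
        \sum_(j < k | j != i)
          mu i * mu j * ((p i).2 - (p j).2) / dist (p i) (p j) ^+ 3].

Definition on_x_axis : set ('I_k -> R * R) :=
  [set p | forall i, (p i).2 = 0].

Definition on_y_axis : set ('I_k -> R * R) :=
  [set p | forall i, (p i).1 = 0].

Definition collinear p : Prop :=
  exists c d e : R, (c, d) != (0, 0) /\
    forall i, c * (p i).1 + d * (p i).2 = e.

(* Symmetry of the unlabelled configuration: the reflection may exchange
   bodies. *)
Definition symmetric_x p : Prop := reflx @` range p = range p.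

Definition labellings p : set ('I_k -> R * R) :=
  [set p \o s | s in [set: {perm 'I_k}]].

End Bodies.

Definition isosceles_triangle (p : 'I_3 -> R * R) : Prop :=
  ~ collinear p /\
  exists i j l : 'I_3, [/\ i != j, i != l, j != l &
    dist (p i) (p j) = dist (p i) (p l)].

Definition isosceles_symmetric_x : set ('I_3 -> R * R) :=
  [set p | isosceles_triangle p /\ symmetric_x p].

End Configurations.

(* Main.v *)
Require Import Defs.
From HB Require Import structures.
From mathcomp Require Import all_boot all_order all_algebra all_fingroup.
From mathcomp Require Import boolp classical_sets functions cardinality reals.
From mathcomp Require Import lra.

Set Implicit Arguments.
Unset Strict Implicit.
Unset Printing Implicit Defensive.

Import Order.TTheory GRing.Theory Num.Theory.

Local Open Scope classical_set_scope.
Local Open Scope card_scope.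
Local Open Scope ring_scope.

(** Put w_ij = 1 / (3 r_ij^3).  The system says that the coordinate vectors x
    and y satisfy L x = a x and L y = b y for the graph Laplacian L with weights
    w_ij.  If neither vector vanishes, then x, y and (1,1,1) are orthogonal
    eigenvectors, and for a = 3/4, b = 9/4 this determines the weights:
    2 |y|^2 w_ij = (y_i - y_j)^2.  Consequently r_ij^2 = A + B w_ij with the
    same A, B for the three pairs, so the three distances are positive roots of
    one polynomial z^5 - A z^3 - B', which has at most two such roots.
    Hence two distances agree; their common vertex lies on the x axis, w takes
    the values 1/4, 1/4, 1, and the triangle is determined up to reflections.
    In the collinear case, with gaps d, e between consecutive bodies, the
    equations give a (d - e) = 1/d^2 - 1/e^2, so d = e by monotonicity. *)

(** * Three labels, relabellings and their count *)

Lemma uniq3E (A : eqType) (u v w : A) :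
  uniq [:: u; v; w] = [&& u != v, u != w & v != w].
Proof. by rewrite /= !inE negb_or andbT andbA. Qed.

Lemma forall_ord3 (P : 'I_3 -> Prop) :
  P 0 -> P 1 -> P (inord 2) -> forall i, P i.
Proof.
have ord3E (x y : 'I_3) : x = y :> nat -> P x -> P y by move=> /val_inj ->.
move=> P0 P1 P2 [[|[|[|//]]] lti].
- exact: ord3E P0.
- exact: ord3E P1.
- by apply: ord3E P2; rewrite /= inordK.
Qed.

(** Pigeonhole: a fourth distinct label would not fit in ['I_3]. *)
Lemma ord3_cover (i j l m : 'I_3) :
  uniq [:: i; j; l] -> [|| m == i, m == j | m == l].
Proof.
move=> uq; apply: contraT => nm.
have /card_uniqP /= c4 : uniq [:: m; i; j; l] by rewrite cons_uniq !inE nm uq.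
by have := max_card (mem [:: m; i; j; l]); rewrite c4 card_ord.
Qed.

Lemma sum_ord3_neq (V : nmodType) (F : 'I_3 -> V) (i j l : 'I_3) :
  uniq [:: i; j; l] -> \sum_(m < 3 | m != i) F m = F j + F l.
Proof.
move=> uq; have /and3P[nij nil njl] : [&& i != j, i != l & j != l]
  by rewrite -uniq3E.
rewrite (bigD1 j) 1?eq_sym //= (bigD1 l) /=; last
  by rewrite ![l == _]eq_sym nil.
rewrite big1 ?addr0// => m /andP[/andP[nmi nmj] nml].
by have := ord3_cover m uq; rewrite (negPf nmi) (negPf nmj) (negPf nml).
Qed.

Lemma comp_tnth3 (A B : Type) (f : A -> B) (u v w : A) :
  f \o tnth [tuple u; v; w] = tnth [tuple f u; f v; f w].
Proof. by apply/funext; case=> [[|[|[|//]]] ?];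
  rewrite !(tnth_nth u, tnth_nth (f u)). Qed.

Lemma tnth3_inj (A : eqType) (u v w : A) :
  uniq [:: u; v; w] -> injective (tnth [tuple u; v; w]).
Proof. by move=> uq i j /eqP; rewrite !(tnth_nth u) nth_uniq ?size_tuple// =>
  /eqP /val_inj. Qed.

(** Listing the bodies in a convenient order is composition with a permutation [s]; the inverse of
    [s] restores the given labels. *)
Lemma labellings_tnth3 (R : realType) (p : 'I_3 -> R * R) (i j l : 'I_3) :
  uniq [:: i; j; l] -> labellings (tnth [tuple p i; p j; p l]) p.
Proof.
move=> uq; pose s := perm (tnth3_inj uq).
exists (s^-1)%g => //; rewrite -comp_tnth3; apply/funext => m /=.
by rewrite -[tnth _ _](permE (tnth3_inj uq)) -/s permKV.
Qed.

(** With equal masses the system is invariant under relabelling: each sum over the other bodies is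
    only reindexed by [s]. *)
Lemma labellings_sub (R : realType) k (a b m : R) (T : 'I_k -> R * R) :
  solutions a b (fun=> m) T -> labellings T `<=` solutions a b (fun=> m).
Proof.
move=> [injT eqT] _ [s _ <-]; split; first exact: inj_comp injT perm_inj.
have sumE (G : 'I_k -> R) i :
    \sum_(j < k | j != i) G (s j) = \sum_(j < k | j != s i) G j.
  by rewrite [RHS](reindex_inj (@perm_inj _ s)); apply: eq_bigl => j;
    rewrite (inj_eq perm_inj).
move=> i /=; have [-> ->] := eqT (s i).
by split; rewrite -sumE.
Qed.

Lemma card_setT_fin (T : finType) : [set: T] #= `I_#|T|.
Proof.
have <- : (fun x : T => nat_of_ord (enum_rank x)) @` setT = `I_#|T|.
  apply/seteqP; split=> [_ [x _ <-]|n ltn] /=; first exact: ltn_ord.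
  by exists (enum_val (Ordinal ltn)); rewrite ?enum_valK.
rewrite card_eq_sym; apply: inj_card_eq => x y _ _ /= /val_inj;
  exact: enum_rank_inj.
Qed.

(** Pairs of an index and a permutation parametrise the union injectively: the range ignores the
    permutation and so recovers [c], after which injectivity of [T c] recovers the permutation. *)
Lemma card_labellings (R : realType) k (I : finType) (T : I -> 'I_k -> R * R) :
    (forall c, injective (T c)) ->
    (forall c d, range (T c) = range (T d) -> c = d) ->
  \bigcup_c labellings (T c) #= `I_(#|I| * k`!).
Proof.
move=> injT rangeT; pose F (cs : I * {perm 'I_k}) := T cs.1 \o cs.2.
have -> : \bigcup_c labellings (T c) = F @` [set: I * {perm 'I_k}].
  apply/seteqP; split=> [p [c _ [s _ <-]]|_ [[c s] _ <-]].
    by exists (c, s).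
  by exists c => //; exists s.
have rangeF c (s : {perm 'I_k}) : range (T c \o s) = range (T c).
  apply/seteqP; split=> [_ [i _ <-]|_ [i _ <-]]; first by exists (s i).
  by exists ((s^-1)%g i); rewrite //= permKV.
have injF : injective F.
  move=> [c s] [d t] eqF.
  have ecd : c = d by apply: rangeT; rewrite -(rangeF c s) -(rangeF d t);
    exact: (congr1 (fun f => range f) eqF).
  rewrite -{d}ecd in eqF *; congr (_, _); apply/permP => i.
  exact/(injT c)/(congr1 (fun f => f i) eqF).
apply: (card_eq_trans (inj_card_eq (in2W injF))).
by rewrite -card_Sn -card_prod; exact: card_setT_fin.
Qed.

(** * Cube roots, distances and algebraic tools *)

Lemma cubic_root_exists (R : realType) (z : R) : 0 < z ->
  exists2 r : R, 0 < r & r ^+ 3 = z.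
Proof.
(* The right end [z + 1] serves because its cube exceeds [z] whether [z] is below or above 1. *)
move=> z0; have ivt : ('X^3 - z%:P).[0] <= 0 <= ('X^3 - z%:P).[z + 1].
  rewrite !hornerE; apply/andP; split; first lra.
  have : 0 <= z * z by apply: mulr_ge0; lra.
  have : 0 <= z * z * z by rewrite !mulr_ge0 //; lra.
  lra.
have [|r /andP[r0 _]] := poly_ivt _ ivt; first lra.
rewrite /root !hornerE subr_eq0 => /eqP rz; exists r => //.
by rewrite lt_def r0 andbT; apply: contraTneq z0 => r00;
  rewrite -rz r00 expr0n ltxx.
Qed.

Section Dist.
Variable R : realType.
Implicit Types u v : R * R.

Lemma dist_sqr u v : dist u v ^+ 2 = (u.1 - v.1) ^+ 2 + (u.2 - v.2) ^+ 2.
Proof. by rewrite /dist sqr_sqrtr // addr_ge0 // sqr_ge0. Qed.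

Lemma dist_sym u v : dist u v = dist v u.
Proof. by rewrite /dist -[u.1 - _]opprB -[u.2 - _]opprB !sqrrN. Qed.

Lemma dist_gt0 u v : u != v -> 0 < dist u v.
Proof.
move=> nuv; rewrite /dist sqrtr_gt0 lt_def addr_ge0 ?sqr_ge0 // andbT.
rewrite paddr_eq0 ?sqr_ge0 // !sqrf_eq0 !subr_eq0.
by case: u v nuv => [? ?] [? ?] /=; rewrite xpair_eqE.
Qed.

Lemma distE u v (r : R) :
  0 <= r -> r ^+ 2 = (u.1 - v.1) ^+ 2 + (u.2 - v.2) ^+ 2 ->
  dist u v = r.
Proof. by move=> r0 er; rewrite /dist -er sqrtr_sqr ger0_norm. Qed.

End Dist.

(* The determinant of the three rows (1, z^3, z^5) is the Vandermonde
   determinant times the Schur polynomial s_(3,2), which has positive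
   coefficients. *)
Lemma quintic_roots_eq (R : realFieldType) (A B r s t : R) :
    0 < r -> 0 < s -> 0 < t ->
    r ^+ 5 = A * r ^+ 3 + B -> s ^+ 5 = A * s ^+ 3 + B -> t ^+ 5 = A * t ^+ 3 + B ->
  [\/ r = s, r = t | s = t].
Proof.
move=> r0 s0 t0 er es et.
have schur_gt0 : 0 < r ^+ 3 * s ^+ 2 + r ^+ 2 * s ^+ 3 + r ^+ 3 * t ^+ 2
    + r ^+ 2 * t ^+ 3 + s ^+ 3 * t ^+ 2 + s ^+ 2 * t ^+ 3
    + r ^+ 3 * s * t + r * s ^+ 3 * t + r * s * t ^+ 3
    + 2 * (r ^+ 2 * s ^+ 2 * t + r ^+ 2 * s * t ^+ 2 + r * s ^+ 2 * t ^+ 2).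
  by rewrite !(addr_gt0, mulr_gt0, exprn_gt0).
have : r ^+ 5 * (s ^+ 3 - t ^+ 3) + s ^+ 5 * (t ^+ 3 - r ^+ 3)
    + t ^+ 5 * (r ^+ 3 - s ^+ 3) = 0 by rewrite er es et; lra.
set S := (X in 0 < X) in schur_gt0 => det0.
have /eqP : (r - s) * (r - t) * (s - t) * S = 0 by rewrite -[RHS]det0 /S; lra.
rewrite !mulf_eq0 (gt_eqF schur_gt0) orbF !subr_eq0 => /orP[/orP[]|] /eqP.
- by constructor 1.
- by constructor 2.
- by constructor 3.
Qed.

(* The vector x is a multiple of the cross product of (1,1,1) and y. *)
Lemma orthogonal_zero_sum (R : realFieldType) (x1 x2 x3 y1 y2 y3 : R) :
    x1 + x2 + x3 = 0 -> y1 + y2 + y3 = 0 -> x1 * y1 + x2 * y2 + x3 * y3 = 0 ->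
    (y1, y2, y3) != (0, 0, 0) ->
  exists c, [/\ x1 = c * (y3 - y2), x2 = c * (y1 - y3) & x3 = c * (y2 - y1)].
Proof.
move=> sx sy xy y0; pose Y := y1 ^+ 2 + y2 ^+ 2 + y3 ^+ 2.
have Y0 : Y != 0.
  apply: contraNneq y0 => /eqP; rewrite /Y !paddr_eq0 ?addr_ge0 ?sqr_ge0 //.
  by rewrite !sqrf_eq0 !xpair_eqE.
have ex3 : x3 = - x1 - x2 by lra.
have ey3 : y3 = - y1 - y2 by lra.
(* This is the projection coefficient of x on the cross product: their inner product is
   [3 * (x2 * y1 - x1 * y2)] and the cross product has squared norm [3 * Y]. *)
exists ((x2 * y1 - x1 * y2) / Y).
by split; apply: (mulIf Y0); rewrite mulrAC divfK // /Y; subst x3 y3;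
  have := congr1 ( *%R y1) xy; have := congr1 ( *%R y2) xy; lra.
Qed.

(** * Balance equations and couplings *)

Section Balance.
Variable R : realType.
Implicit Types u v w : R * R.

(* One mass factor 1/3 is absorbed here; the other one, mu_i, cancels. *)
Definition coupling u v : R := (3 * dist u v ^+ 3)^-1.

Lemma coupling_sym u v : coupling u v = coupling v u.
Proof. by rewrite /coupling dist_sym. Qed.

Lemma coupling_gt0 u v : u != v -> 0 < coupling u v.
Proof. by move=> /dist_gt0 r0; rewrite invr_gt0 mulr_gt0 // exprn_gt0. Qed.

Lemma coupling_dist u v : u != v -> coupling u v * (3 * dist u v ^+ 3) = 1.
Proof. by move=> /dist_gt0 r0;
  rewrite mulVf // gt_eqF // mulr_gt0 // exprn_gt0. Qed.

Definition balanced (a b : R) u v w : Prop :=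
  a * u.1 = coupling u v * (u.1 - v.1) + coupling u w * (u.1 - w.1) /\
  b * u.2 = coupling u v * (u.2 - v.2) + coupling u w * (u.2 - w.2).

Lemma balanced_sym a b u v w : balanced a b u v w -> balanced a b u w v.
Proof. by move=> [ex ey]; split; rewrite addrC. Qed.

(** Each sum has two terms and one mass factor cancels. Balance is stated for every ordering of the
    labels, so that later arguments may name the bodies freely. *)
Lemma solutionsP (a b : R) (p : 'I_3 -> R * R) :
  solutions a b (fun=> 1 / 3) p <->
  injective p /\
  forall i j l, uniq [:: i; j; l] -> balanced a b (p i) (p j) (p l).
Proof.
have couplingE (d x : R) : (3 * d)^-1 * x = 3 * (1 / 3 * (1 / 3) * x / d).
  by rewrite invfM; lra.
split=> -[inj_p eqp]; split=> // i.
  move=> j l uq; have [] := eqp i; rewrite !(sum_ord3_neq _ uq) => ex ey.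
  by rewrite /balanced /coupling !couplingE -!mulrDr -ex -ey; split; lra.
have [j [l uq]] : exists j l, uniq [:: i; j; l].
  by elim/forall_ord3: i; [exists 1, (inord 2)|exists 0, (inord 2)|exists 0, 1];
    rewrite uniq3E -!val_eqE /= ?inordK.
have := eqp i j l uq; rewrite /balanced /coupling !couplingE -!mulrDr =>
  -[ex ey].
by rewrite !(sum_ord3_neq _ uq); split; lra.
Qed.

(** One instance of [balanced] per body covers all six orderings, by symmetry in the other two
    bodies. *)
Lemma solutions_tnth3 (a b : R) u v w : uniq [:: u; v; w] ->
    balanced a b u v w -> balanced a b v u w -> balanced a b w u v ->
  solutions a b (fun=> 1 / 3) (tnth [tuple u; v; w]).
Proof.
move=> uq bu bv bw; apply/solutionsP; split; first exact: tnth3_inj.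
move=> i j l; elim/forall_ord3: i; elim/forall_ord3: j; elim/forall_ord3: l;
  rewrite uniq3E -!val_eqE /= ?inordK // => _;
    rewrite !(tnth_nth u) /= ?inordK //;
  by [|exact: balanced_sym].
Qed.

(** The two equations of the body [u] are linear in the two couplings at [u]; eliminating the one
    with [w] leaves an explicit value for the other. *)
Lemma coupling_formula u v w (c : R) : c != 0 ->
    u.2 + v.2 + w.2 = 0 ->
    u.1 = c * (w.2 - v.2) -> v.1 = c * (u.2 - w.2) -> w.1 = c * (v.2 - u.2) ->
    balanced (3 / 4) (9 / 4) u v w ->
  2 * (u.2 ^+ 2 + v.2 ^+ 2 + w.2 ^+ 2) * coupling u v = (u.2 - v.2) ^+ 2.
Proof.
rewrite /balanced; move: (coupling u v) (coupling u w) => muv muw.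
case: u v w => [x1 y1] [x2 y2] [x3 y3] /= c0 sy ex1 ex2 ex3 [ex ey].
(* As the ordinates sum to zero, [x1 - x2 = 3 * c * y3] and [x1 - x3 = - 3 * c * y2]; the factor [c]
   cancels. *)
have {}ex : 3 / 4 * (y3 - y2) = 3 * (muv * y3 - muw * y2).
  apply: (mulfI c0); move: ex; rewrite ex1 ex2 ex3.
  have -> : y1 = - y2 - y3 by lra.
  lra.
have ey1 : y3 = - y1 - y2 by lra.
subst y3.
(* Here [2 * y1 + y2] is [y1 - y3], so up to a factor 3 these multipliers make the terms in [muw]
   cancel. *)
have := congr1 ( *%R y2) ey; have := congr1 ( *%R (2 * y1 + y2)) ex.
lra.
Qed.

(** Summing the equations cancels the symmetric couplings. Pairing the x equations with y and the y
    equations with x gives the same quadratic form, so the distinct eigenvalues 3/4 and 9/4 force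
    orthogonality. *)
Lemma centered u v w :
    balanced (3 / 4) (9 / 4) u v w -> balanced (3 / 4) (9 / 4) v u w ->
    balanced (3 / 4) (9 / 4) w u v ->
  [/\ u.1 + v.1 + w.1 = 0, u.2 + v.2 + w.2 = 0
    & u.1 * u.2 + v.1 * v.2 + w.1 * w.2 = 0].
Proof.
rewrite /balanced (coupling_sym v u) !(coupling_sym w).
move: (coupling _ _) (coupling _ _) (coupling _ _) => m n l.
case: u v w => [x1 y1] [x2 y2] [x3 y3] /= [ex1 ey1] [ex2 ey2] [ex3 ey3].
split; [lra|lra|].
have := congr1 ( *%R y1) ex1; have := congr1 ( *%R y2) ex2;
  have := congr1 ( *%R y3) ex3.
have := congr1 ( *%R x1) ey1; have := congr1 ( *%R x2) ey2;
  have := congr1 ( *%R x3) ey3.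
lra.
Qed.

(** * Configurations off both axes *)

Section OffAxes.
Variables u v w : R * R.
Hypotheses (nuv : u != v) (nuw : u != w) (nvw : v != w).
Hypotheses (bu : balanced (3 / 4) (9 / 4) u v w)
  (bv : balanced (3 / 4) (9 / 4) v u w) (bw : balanced (3 / 4) (9 / 4) w u v).
Hypotheses (x0 : (u.1, v.1, w.1) != (0, 0, 0))
  (y0 : (u.2, v.2, w.2) != (0, 0, 0)).

Let Y := u.2 ^+ 2 + v.2 ^+ 2 + w.2 ^+ 2.

Lemma off_axes_couplings : exists c,
  [/\ c != 0, u.2 + v.2 + w.2 = 0,
      [/\ u.1 = c * (w.2 - v.2), v.1 = c * (u.2 - w.2) & w.1 = c * (v.2 - u.2)]
    & [/\ 2 * Y * coupling u v = (u.2 - v.2) ^+ 2,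
          2 * Y * coupling u w = (u.2 - w.2) ^+ 2
        & 2 * Y * coupling v w = (v.2 - w.2) ^+ 2]].
Proof.
have [sx sy sxy] := centered bu bv bw.
have [c [eu ev ew]] := orthogonal_zero_sum sx sy sxy y0.
have c0 : c != 0 by apply: contraNneq x0 => c0; rewrite eu ev ew c0 !mul0r.
exists c; split=> //; rewrite /Y; split.
- exact: (coupling_formula c0).
(* Exchanging [v] and [w] reverses the cross product, hence [- c]; the cyclic shift in the next case
   keeps [c]. *)
- rewrite -(@coupling_formula u w v (- c)) ?oppr_eq0 //; first 1 last.
  all: try lra.
  exact: balanced_sym.
- rewrite -(@coupling_formula v w u c) //; try lra.
  exact: balanced_sym.
Qed.

Lemma off_axes_isosceles :
  [\/ dist u v = dist u w, dist u v = dist v w | dist u w = dist v w].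
Proof.
have [c [c0 sy [eu ev ew] [muv muw mvw]]] := off_axes_couplings.
(* With k the third body, x_i - x_j is 3 c y_k up to sign, and 3 y_k^2 = 2 Y - (y_i - y_j)^2. Hence
   r_ij^2 = 6 c^2 Y + (1 - 3 c^2) (y_i - y_j)^2, where the last square is 2 Y w_ij. *)
pose A := 6 * c ^+ 2 * Y; pose B := 2 * Y * (1 - 3 * c ^+ 2) / 3.
have quintic a b : a != b ->
    dist a b ^+ 2 = A + 3 * B * coupling a b ->
    dist a b ^+ 5 = A * dist a b ^+ 3 + B.
  move=> /coupling_dist m1 er; rewrite (exprD _ 2 3) er.
  by have := congr1 ( *%R B) m1; lra.
apply: (quintic_roots_eq (A := A) (B := B)); rewrite ?dist_gt0 //;
  apply: quintic => //; rewrite dist_sqr ?eu ?ev ?ew /A /B;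
  [have := congr1 ( *%R (1 - 3 * c ^+ 2)) muv
  |have := congr1 ( *%R (1 - 3 * c ^+ 2)) muw
  |have := congr1 ( *%R (1 - 3 * c ^+ 2)) mvw];
  rewrite /Y; have -> : w.2 = - u.2 - v.2 by lra.
all: lra.
Qed.

(** The lengths [r] and [s] are those with coupling 1 and 1/4. Once the apex [u] is known to have
    ordinate 0, Y is twice the square of [v.2], so the base has coupling 1 and the legs 1/4. *)
Lemma off_axes_apex (r s : R) :
  0 < r -> r ^+ 3 = 1 / 3 -> 0 < s -> s ^+ 3 = 4 / 3 ->
    dist u v = dist u w ->
  [/\ u.2 = 0, w.2 = - v.2, w.1 = v.1, u.1 = - 2 * v.1
    & 4 * v.2 ^+ 2 = r ^+ 2 /\ 9 * v.1 ^+ 2 + v.2 ^+ 2 = s ^+ 2].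
Proof.
move=> r0 er s0 es euvw.
have [c [c0 sy [eu ev ew] [muv muw mvw]]] := off_axes_couplings.
have Y0 : 0 < Y.
  rewrite lt_def !addr_ge0 ?sqr_ge0 // andbT.
  by apply: contraNneq y0 => /eqP; rewrite /Y !paddr_eq0 ?addr_ge0 ?sqr_ge0 //
    !sqrf_eq0 !xpair_eqE.
have ew2 : w.2 = - u.2 - v.2 by lra.
have nyvw : v.2 - w.2 != 0.
  apply: contraTneq (coupling_gt0 nvw) => e0; move: mvw;
    rewrite e0 expr0n /= => /eqP.
  by rewrite !mulf_eq0 (gt_eqF Y0) pnatr_eq0 /= => /eqP ->; rewrite ltxx.
(* Equal legs give equal couplings, hence equal squares of [u.2 - v.2] and [u.2 - w.2]. As [v.2] and
   [w.2] differ, [u.2] is their midpoint, and the zero sum makes it 0. *)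
have u20 : u.2 = 0.
  apply: (mulIf nyvw); rewrite mul0r.
  have : (u.2 - v.2) ^+ 2 = (u.2 - w.2) ^+ 2
    by rewrite -muv -muw /coupling euvw.
  by rewrite ew2; lra.
have v20 : v.2 != 0 by apply: contraNneq nyvw; rewrite ew2 u20 => ->;
  rewrite !oppr0 addr0 subr0.
have EY : Y = 2 * v.2 ^+ 2 by rewrite /Y ew2 u20; lra.
have v2sq : v.2 ^+ 2 != 0 by rewrite expf_neq0.
have cvw : coupling v w = 1 by apply: (mulfI v2sq); move: mvw;
  rewrite EY ew2 u20; lra.
have cuv : coupling u v = 1 / 4 by apply: (mulfI v2sq); move: muv;
  rewrite EY ?ew2 u20; lra.
have cube_inj (x y : R) : 0 < x -> 0 < y -> x ^+ 3 = y ^+ 3 -> x = y.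
  by move=> x0' y0' /eqP; rewrite eqrXn2 ?ltW // => /eqP.
have dvw : dist v w = r.
  apply: cube_inj; rewrite ?dist_gt0 //; have := coupling_dist nvw;
    rewrite cvw er; lra.
have duv : dist u v = s.
  apply: cube_inj; rewrite ?dist_gt0 //; have := coupling_dist nuv;
    rewrite cuv es; lra.
have := dist_sqr v w; have := dist_sqr u v; rewrite dvw duv eu ev ew ew2 u20.
split; try lra; split; lra.
Qed.

End OffAxes.
End Balance.

(** * Collinear configurations on the axes *)

Section Axes.
Variable R : realType.
Implicit Types (a b r : R) (p : 'I_3 -> R * R).

Lemma injective_ord3_sorted (f : 'I_3 -> R) : injective f ->
  exists i j l, [/\ uniq [:: i; j; l], f i < f j & f j < f l].
Proof.
move=> inj_f; have neq i j : i != j -> f i != f j by rewrite (inj_eq inj_f).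
have uq : uniq [:: 0; 1; inord 2 : 'I_3] by rewrite uniq3E -!val_eqE /= ?inordK.
move: uq; move: 0 1 (inord 2) => i j l; rewrite uniq3E => /and3P[nij nil njl].
have := neq _ _ njl; have := neq _ _ nil; have := neq _ _ nij.
have [nji nli nlj] : [/\ j != i, l != i & l != j] by split; rewrite eq_sym.
case: (ltgtP (f i) (f j)) => // ij _; case: (ltgtP (f i) (f l)) => // il _;
  case: (ltgtP (f j) (f l)) => // jl _.
- by exists i, j, l; rewrite uniq3E nij nil njl.
- by exists i, l, j; rewrite uniq3E nij nil nlj.
- by have := lt_trans ij (lt_trans jl il); rewrite ltxx.
- by exists l, i, j; rewrite uniq3E nij nli nlj.
- by exists j, i, l; rewrite uniq3E nji nil njl.
- by have := lt_trans jl (lt_trans ij il); rewrite ltxx.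
- by exists j, l, i; rewrite uniq3E nji nli njl.
- by exists l, j, i; rewrite uniq3E nji nli nlj.
Qed.

Definition x_axis_triple r : 'I_3 -> R * R :=
  tnth [tuple (- r, 0); (0, 0); (r, 0)].

Lemma x_axis_triple_uniq r : 0 < r -> uniq [:: (- r, 0); (0, 0); (r, 0 : R)].
Proof. by move=> r0; rewrite uniq3E !xpair_eqE !eqxx !andbT; apply/and3P;
  split; lra. Qed.

Lemma dist_x_axis u v (d : R) :
  u.2 = 0 -> v.2 = 0 -> u.1 <= v.1 -> v.1 - u.1 = d ->
  dist u v = d.
Proof. by move=> eu ev luv <-; apply: distE; rewrite ?subr_ge0 // eu ev;
  lra. Qed.

Lemma coupling_eq u v (m : R) : m * (3 * dist u v ^+ 3) = 1 -> coupling u v = m.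
Proof.
move=> em; by apply/esym/divr1_eq; rewrite /coupling invrK.
Qed.

(** The value of [r ^+ 3] is the balance of an outer body, with neighbours at distances r and 2 r: a
    r = (1/3) (1/r^2 + 1/(4 r^2)). *)
Lemma x_axis_triple_solution a b r : 0 < a -> 0 < r -> r ^+ 3 = 5 / (12 * a) ->
  solutions a b (fun=> 1 / 3) (x_axis_triple r).
Proof.
move=> a0 r0 er.
have ar : 12 * a * r ^+ 3 = 5 by rewrite er mulrC divfK // mulf_neq0 // gt_eqF.
have duv : dist (- r, 0) (0, 0) = r by apply: dist_x_axis => /=; lra.
have dvw : dist (0, 0) (r, 0) = r by apply: dist_x_axis => /=; lra.
have duw : dist (- r, 0) (r, 0) = 2 * r by apply: dist_x_axis => /=; lra.
have cuv : coupling (- r, 0) (0, 0) = 4 / 5 * a by apply: coupling_eq;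
  rewrite duv; lra.
have cvw : coupling (0, 0) (r, 0) = 4 / 5 * a by apply: coupling_eq;
  rewrite dvw; lra.
have cuw : coupling (- r, 0) (r, 0) = a / 10 by apply: coupling_eq;
  rewrite duw; lra.
apply: (solutions_tnth3 (x_axis_triple_uniq r0));
  rewrite /balanced ?(coupling_sym (0, 0) (- r, 0)) ?(coupling_sym (r, 0)) ?cuv ?cvw ?cuw /=;
  split; lra.
Qed.

Lemma x_axis_balanced a b r u v w : 0 < a -> 0 < r -> r ^+ 3 = 5 / (12 * a) ->
    u.2 = 0 -> v.2 = 0 -> w.2 = 0 -> u.1 < v.1 -> v.1 < w.1 ->
    balanced a b u v w -> balanced a b v u w -> balanced a b w u v ->
  [/\ u = (- r, 0), v = (0, 0) & w = (r, 0)].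
Proof.
case: u v w => [x1 y1] [x2 y2] [x3 y3] /= a0 r0 er y10 y20 y30 l12 l23.
subst y1 y2 y3.
have ar : 12 * a * r ^+ 3 = 5 by rewrite er mulrC divfK // mulf_neq0 // gt_eqF.
rewrite /balanced (coupling_sym (x2, 0) (x1, 0)) !(coupling_sym (x3, 0)) /=.
have d12 : dist (x1, 0) (x2, 0) = x2 - x1 by apply: dist_x_axis => //=;
  exact: ltW.
have d23 : dist (x2, 0) (x3, 0) = x3 - x2 by apply: dist_x_axis => //=;
  exact: ltW.
have d13 : dist (x1, 0) (x3, 0) = x3 - x1 by apply: dist_x_axis => //=; lra.
have neq (x y : R) : x < y -> (x, 0) != (y, 0 : R) by move=> lxy;
  rewrite xpair_eqE lt_eqF.
have := coupling_dist (neq _ _ l12); rewrite d12.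
have := coupling_dist (neq _ _ l23); rewrite d23.
have := coupling_dist (neq _ _ (lt_trans l12 l23)); rewrite d13.
move: (coupling (x1, 0) (x2, 0)) (coupling (x2, 0) (x3, 0)) (coupling (x1, 0) (x3, 0)).
move=> P Q W eW eQ eP [e1 _] [e2 _] [e3 _].
have [d ed] : exists d, d = x2 - x1 by exists (x2 - x1).
have [e ee] : exists e, e = x3 - x2 by exists (x3 - x2).
have ex2 : x2 = x1 + d by lra.
have ex3 : x3 = x1 + d + e by lra.
subst x2 x3; have d0 : 0 < d by lra.
have e0 : 0 < e by lra.
have ede : e = d.
  have pos : 0 < a * d ^+ 2 * e ^+ 2 + d + e
    by rewrite !addr_gt0 ?mulr_gt0 ?exprn_gt0.
  (* The abscissas sum to zero, so [e - d] is -3 times the middle one; this is the equation of the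
     middle body. *)
  have E : a * (e - d) = 3 * (Q * e - P * d) by lra.
  have := congr1 ( *%R (d ^+ 2 * e ^+ 2)) E.
  have := congr1 ( *%R (d ^+ 2)) eQ; have := congr1 ( *%R (e ^+ 2)) eP =>
    eP' eQ' E'.
  (* Substituting 3 P d = 1/d^2 and 3 Q e = 1/e^2 and clearing denominators yields a product with a
     positive second factor. *)
  have /eqP : (e - d) * (a * d ^+ 2 * e ^+ 2 + d + e) = 0 by lra.
  by rewrite mulf_eq0 (gt_eqF pos) orbF subr_eq0 => /eqP.
subst e; have d3 : d ^+ 3 != 0 by rewrite expf_neq0 // gt_eqF.
have eQP : Q = P by apply: (mulIf d3); lra.
have eWP : W = P / 8 by apply: (mulIf d3); lra.
subst Q W.
have x1d : x1 = - d.
  have a0' : a != 0 by rewrite gt_eqF.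
  by apply: (mulfI a0'); lra.
subst x1.
have edr : d = r.
  apply/eqP; rewrite -(@eqrXn2 _ 3) ?ltW //; apply/eqP.
  have a0' : a != 0 by rewrite gt_eqF.
  apply: (mulfI a0').
  by have := congr1 ( *%R (d ^+ 2)) e1; lra.
by subst d; split; congr (_, _); lra.
Qed.

Lemma x_axis_solutions a b r : 0 < a -> 0 < r -> r ^+ 3 = 5 / (12 * a) ->
  solutions a b (fun=> 1 / 3) `&` @on_x_axis R 3 = labellings (x_axis_triple r).
Proof.
move=> a0 r0 er; apply/seteqP; split=> [p [/solutionsP[inj_p bal_p] p2]|p Lp];
  last first.
  split; first exact: labellings_sub (x_axis_triple_solution b a0 r0 er) _ Lp.
  by case: Lp => s _ <- i /=; rewrite /x_axis_triple; elim/forall_ord3: (s i);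
    rewrite (tnth_nth (0, 0)) /= ?inordK.
have inj_p1 : injective (fun i => (p i).1).
  by move=> i j eij; apply: inj_p;
    rewrite [LHS]surjective_pairing [RHS]surjective_pairing eij !p2.
have [i [j [l [uq lij ljl]]]] := injective_ord3_sorted inj_p1.
have uqj : uniq [:: j; i; l] by move: uq; rewrite !uniq3E (eq_sym j i) =>
  /and3P[-> -> ->].
have uql : uniq [:: l; i; j] by move: uq; rewrite !uniq3E !(eq_sym l) =>
  /and3P[-> -> ->].
have := labellings_tnth3 p uq.
by have [-> -> ->] := x_axis_balanced a0 r0 er (p2 i) (p2 j) (p2 l) lij ljl
  (bal_p _ _ _ uq) (bal_p _ _ _ uqj) (bal_p _ _ _ uql).
Qed.

(** Exchanging the coordinates exchanges a and b, which reduces the y axis to the x axis. *)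
Definition swap (u : R * R) : R * R := (u.2, u.1).

Lemma swapK : involutive swap. Proof. by case. Qed.

Lemma solutions_swap k a b (mu : 'I_k -> R) (p : 'I_k -> R * R) :
  solutions a b mu p -> solutions b a mu (swap \o p).
Proof.
move=> [inj_p eqp]; split; first exact: inj_comp (can_inj swapK) inj_p.
by move=> i; have [ex ey] := eqp i; split; rewrite /= ?ex ?ey;
  apply: eq_bigr => j _; rewrite /dist /= [X in Num.sqrt X]addrC.
Qed.

Lemma y_axis_solutions a b r : 0 < b -> 0 < r -> r ^+ 3 = 5 / (12 * b) ->
  solutions a b (fun=> 1 / 3) `&` @on_y_axis R 3 = labellings (swap \o x_axis_triple r).
Proof.
move=> b0 r0 er; have := x_axis_solutions a b0 r0 er => /seteqP[sub1 sub2].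
have swapp p : swap \o (swap \o p) = p by apply/funext => i; exact: swapK.
apply/seteqP; split=> [p [Sp p1]|_ [s _ <-]].
  have [//|s _ es] := sub1 (swap \o p) _; first by split; first
    exact: solutions_swap.
  by exists s; rewrite // -[RHS]swapp -es.
have [|S0 p2] := sub2 (x_axis_triple r \o s); first by exists s.
by split; first exact: (solutions_swap S0).
Qed.

End Axes.

(** * Isosceles triangles *)

Section Triangle.
Variable R : realType.
Implicit Types (h c : R) (p : 'I_3 -> R * R).

(** The apex at [- 2 * h] puts the centre of mass at the origin; the base is vertical of length 2
    |c|, and the sign of [h] tells the triangle from its mirror image. *)
Definition triangle h c : 'I_3 -> R * R :=
  tnth [tuple (- 2 * h, 0); (h, c); (h, - c)].

Lemma refly_triangle h c : @refly R \o triangle h c = triangle (- h) c.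
Proof. by rewrite /triangle comp_tnth3 /refly /= mulrN mulNr. Qed.

Lemma triangle_uniq h c : h != 0 -> c != 0 ->
  uniq [:: (- 2 * h, 0); (h, c); (h, - c)].
Proof.
move=> h0 c0;
  rewrite uniq3E !xpair_eqE ![0 == _]eq_sym oppr_eq0 (negPf c0) !andbF /=.
by rewrite eqxx -subr_eq0 opprK -mulr2n mulrn_eq0.
Qed.

Lemma triangle_solution h c (r s : R) :
    0 < r -> r ^+ 3 = 1 / 3 -> 0 < s -> s ^+ 3 = 4 / 3 -> h != 0 -> c != 0 ->
    4 * c ^+ 2 = r ^+ 2 -> 9 * h ^+ 2 + c ^+ 2 = s ^+ 2 ->
  solutions (3 / 4) (9 / 4) (fun=> 1 / 3) (triangle h c).
Proof.
move=> r0 er s0 es h0 c0 ec eh.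
have duv : dist (- 2 * h, 0) (h, c) = s by apply: distE; rewrite ?ltW //=; lra.
have duw : dist (- 2 * h, 0) (h, - c) = s by apply: distE; rewrite ?ltW //=;
  lra.
have dvw : dist (h, c) (h, - c) = r by apply: distE; rewrite ?ltW //=; lra.
have cuv : coupling (- 2 * h, 0) (h, c) = 1 / 4 by apply: coupling_eq;
  rewrite duv es; lra.
have cuw : coupling (- 2 * h, 0) (h, - c) = 1 / 4 by apply: coupling_eq;
  rewrite duw es; lra.
have cvw : coupling (h, c) (h, - c) = 1 by apply: coupling_eq; rewrite dvw er;
  lra.
apply: (solutions_tnth3 (triangle_uniq h0 c0)); rewrite /balanced
  ?(coupling_sym (h, c) (- 2 * h, 0)) ?(coupling_sym (h, - c)) ?cuv ?cuw ?cvw /=;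
  split; lra.
Qed.

Lemma triangle_isosceles_symmetric h c : h != 0 -> c != 0 ->
  labellings (triangle h c) `<=` @isosceles_symmetric_x R.
Proof.
move=> h0 c0 _ [s _ <-]; pose i m := (s^-1)%g m.
have T0 : (triangle h c \o s) (i 0) = (- 2 * h, 0) by rewrite /i /= permKV.
have T1 : (triangle h c \o s) (i 1) = (h, c) by rewrite /i /= permKV.
have T2 : (triangle h c \o s) (i (inord 2)) = (h, - c).
  by rewrite /i /= permKV /triangle (tnth_nth (0, 0)) /= inordK.
split; first split.
- case=> x [y [e [xy0 eT]]].
  have := eT (i 0); have := eT (i 1); have := eT (i (inord 2)).
  rewrite T0 T1 T2 /= => e2 e1 e0.
  (* The base vertices differ only in ordinate, which forces [y = 0]; apex and base differ in
     abscissa, which then forces [x = 0]. *)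
  have y0 : y = 0 by apply: (mulIf c0); lra.
  have x0 : x = 0 by apply: (mulIf h0); lra.
  by rewrite x0 y0 eqxx in xy0.
- exists (i 0), (i 1), (i (inord 2)); rewrite T0 T1 T2 /i !(inj_eq perm_inj).
  rewrite -!val_eqE /= !inordK //; split=> //.
  by rewrite /dist /= !sub0r opprK sqrrN.
(* The reflection fixes the apex and exchanges the two base vertices. *)
- have reflT j : exists l, triangle h c l = reflx (triangle h c j).
    elim/forall_ord3: j; [exists 0|exists (inord 2)|exists 1];
      by rewrite /triangle !(tnth_nth (0, 0)) /= ?inordK //= /reflx /= ?oppr0 ?opprK.
  apply/seteqP; split=> [_ [_ [j _ <-] <-]|_ [j _ <-]] /=;
    have [l el] := reflT (s j).
    by exists ((s^-1)%g l); rewrite //= permKV.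
  exists (triangle h c l); first by exists ((s^-1)%g l); rewrite //= permKV.
  by rewrite el /reflx /= opprK -surjective_pairing.
Qed.

Lemma on_axis_not_isosceles p :
  on_x_axis p \/ on_y_axis p -> ~ isosceles_symmetric_x p.
Proof.
move=> axis [[ncol _] _]; apply: ncol; case: axis => p0.
- by exists 0, 1, 0; rewrite xpair_eqE oner_eq0 andbF; split=> // i;
  rewrite p0 mul0r mulr0 addr0.
- by exists 1, 0, 0; rewrite xpair_eqE oner_eq0; split=> // i;
  rewrite p0 mul0r mulr0 addr0.
Qed.

(** Two sides agree, and whichever body is their common vertex serves as apex; the squares of the
    coordinates are then fixed and only signs remain. *)
Lemma off_axes_triangle (r s h c : R) p :
    0 < r -> r ^+ 3 = 1 / 3 -> 0 < s -> s ^+ 3 = 4 / 3 ->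
    4 * c ^+ 2 = r ^+ 2 -> 9 * h ^+ 2 + c ^+ 2 = s ^+ 2 ->
    solutions (3 / 4) (9 / 4) (fun=> 1 / 3) p -> ~ on_x_axis p -> ~ on_y_axis p ->
  (labellings (triangle h c) `|` labellings (triangle (- h) c)) p.
Proof.
move=> r0 er s0 es ec eh /solutionsP[inj_p bal_p] nx ny.
have neq i j : i != j -> p i != p j by rewrite (inj_eq inj_p).
have sides i j l : uniq [:: i; j; l] ->
    [/\ uniq [:: j; i; l], uniq [:: l; i; j]
      & [/\ p i != p j, p i != p l & p j != p l]].
  rewrite !uniq3E (eq_sym j i) !(eq_sym l) => /and3P[nij nil njl].
  by rewrite nij nil njl; split; last split; rewrite ?neq.
have uq0 : uniq [:: 0; 1; inord 2 : 'I_3]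
  by rewrite uniq3E -!val_eqE /= ?inordK.
have offx i j l : uniq [:: i; j; l] -> ((p i).1, (p j).1, (p l).1) != (0, 0, 0).
  move=> uq; apply/eqP => -[ei ej el]; apply: ny => m.
  by have /or3P[] := ord3_cover m uq => /eqP ->.
have offy i j l : uniq [:: i; j; l] -> ((p i).2, (p j).2, (p l).2) != (0, 0, 0).
  move=> uq; apply/eqP => -[ei ej el]; apply: nx => m.
  by have /or3P[] := ord3_cover m uq => /eqP ->.
have apex i j l : uniq [:: i; j; l] -> dist (p i) (p j) = dist (p i) (p l) ->
    (labellings (triangle h c) `|` labellings (triangle (- h) c)) p.
  move=> uq eij; have [uqj uql [nij nil njl]] := sides _ _ _ uq.
  have [pi2 pl2 pl1 pi1 [ec' eh']] := off_axes_apex nij njl (bal_p _ _ _ uq)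
    (bal_p _ _ _ uqj) (bal_p _ _ _ uql) (offx _ _ _ uq) (offy _ _ _ uq) r0 er s0 es eij.
  have uq' : uniq [:: i; l; j] by move: uq; rewrite !uniq3E (eq_sym l) =>
    /and3P[-> -> ->].
  (* Both orders of the base are kept: a wrong sign of the ordinate [c] is undone by exchanging the
     base labels, while the sign of [h] selects the triangle. *)
  have := labellings_tnth3 p uq; have := labellings_tnth3 p uq'.
  have -> : p i = (- 2 * (p j).1, 0) by rewrite -pi1 -pi2 -surjective_pairing.
  have -> : p l = ((p j).1, - (p j).2) by rewrite -pl1 -pl2 -surjective_pairing.
  rewrite [p j]surjective_pairing.
  have /eqP : (p j).1 ^+ 2 = h ^+ 2 by lra.
  have /eqP : (p j).2 ^+ 2 = c ^+ 2 by lra.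
  rewrite !eqf_sqr => /orP[] /eqP -> /orP[] /eqP ->; rewrite ?opprK => L' L;
    by [left|right].
have [uq1 uq2 [n01 n02 n12]] := sides _ _ _ uq0.
have [] := off_axes_isosceles n01 n02 n12 (bal_p _ _ _ uq0) (bal_p _ _ _ uq1)
  (bal_p _ _ _ uq2) (offx _ _ _ uq0) (offy _ _ _ uq0).
- exact: apex.
- by rewrite (dist_sym (p 0)); exact: apex.
- by rewrite (dist_sym (p 0)) (dist_sym (p 1)); exact: apex.
Qed.

End Triangle.

(** * Classification and count *)

Theorem mainTheorem3 (R : realType) :
  let Sol : set ('I_3 -> R * R) :=
    solutions (3 / 4) (9 / 4) (fun _ => 1 / 3) in
  [/\ Sol #= `I_24 /\ 24%N = (4 * 3`!)%N,
      Sol `&` @on_x_axis R 3 #= `I_(3`!),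
      Sol `&` @on_y_axis R 3 #= `I_(3`!),
      Sol `&` @isosceles_symmetric_x R #= `I_(2 * 3`!) /\
      (exists T : 'I_3 -> R * R,
        Sol `&` @isosceles_symmetric_x R =
          labellings T `|` labellings (@refly R \o T)) &
      Sol = (Sol `&` @on_x_axis R 3) `|` (Sol `&` @on_y_axis R 3) `|`
          (Sol `&` @isosceles_symmetric_x R)].
Proof.
move=> Sol.
(* [r] is the base and [s] the leg of the triangle; [x] and [y] are the gaps of the collinear
   solutions on the two axes. *)
have [r r0 er] := @cubic_root_exists R (1 / 3) ltac:(lra).
have [s s0 es] := @cubic_root_exists R (4 / 3) ltac:(lra).
have [x x0 ex] := @cubic_root_exists R (5 / (12 * (3 / 4))) ltac:(lra).
have [y y0 ey] := @cubic_root_exists R (5 / (12 * (9 / 4))) ltac:(lra).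
pose c := r / 2; have c0 : 0 < c by rewrite /c; lra.
have ec : 4 * c ^+ 2 = r ^+ 2 by rewrite /c; lra.
have ltrs : r < s by rewrite -(ltr_pXn2r (_ : 0 < 3)%N) ?nnegrE ?ltW // er es;
  lra.
(* The leg spans [3 * h] horizontally and [c] vertically, which dictates this value of h^2; it is
   positive since c < r < s. *)
have h2 : 0 < (s ^+ 2 - c ^+ 2) / 9.
  have : r ^+ 2 < s ^+ 2 by rewrite ltr_pXn2r ?nnegrE ?ltW.
  by rewrite -ec; have := exprn_gt0 2 c0; lra.
pose h := Num.sqrt ((s ^+ 2 - c ^+ 2) / 9); have h0 : 0 < h
  by rewrite sqrtr_gt0.
have eh : 9 * h ^+ 2 + c ^+ 2 = s ^+ 2 by rewrite sqr_sqrtr ?ltW //; lra.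
have eh' : 9 * (- h) ^+ 2 + c ^+ 2 = s ^+ 2 by rewrite sqrrN.
have hn0 : h != 0 by rewrite gt_eqF.
have hn0' : - h != 0 by rewrite oppr_eq0.
have cn0 : c != 0 by rewrite gt_eqF.
have a0 : (0 : R) < 3 / 4 by lra.
have b0 : (0 : R) < 9 / 4 by lra.
pose X := x_axis_triple x; pose Y := @swap R \o x_axis_triple y;
  pose T := triangle h c.
have SolX : Sol `&` @on_x_axis R 3 = labellings X by exact: x_axis_solutions.
have SolY : Sol `&` @on_y_axis R 3 = labellings Y by exact: y_axis_solutions.
have eT' : triangle (- h) c = @refly R \o T by rewrite refly_triangle.
have SolT : Sol `&` @isosceles_symmetric_x R = labellings T `|` labellings (@refly R \o T).
  apply/seteqP; split=> p.
    move=> [Sp Ip]; rewrite -eT'.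
    by apply: (off_axes_triangle r0 er s0 es ec eh Sp) => axis;
      case: (on_axis_not_isosceles _ Ip); [left|right].
  rewrite -eT' => -[] Lp; split.
  - exact: labellings_sub (triangle_solution r0 er s0 es hn0 cn0 ec eh) _ Lp.
  - exact: triangle_isosceles_symmetric Lp.
  - exact: labellings_sub (triangle_solution r0 er s0 es hn0' cn0 ec eh') _ Lp.
  - exact: triangle_isosceles_symmetric Lp.
have SolE : Sol = (Sol `&` @on_x_axis R 3) `|` (Sol `&` @on_y_axis R 3) `|`
    (Sol `&` @isosceles_symmetric_x R).
  apply/seteqP; split=> [p Sp|p [[[]|[]]|[]]] //.
  have [px|px] := pselect (on_x_axis p); first by left; left.
  have [py|py] := pselect (on_y_axis p); first by left; right.
  by right; rewrite SolT -eT'; exact: (off_axes_triangle r0 er s0 es ec eh Sp).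
(* The four shapes share one finite index type, so that a single count gives 4 * 3! and its
   restriction to triangles gives 2 * 3!. *)
pose F (cd : bool * bool) := if cd.1 then (if cd.2 then T else @refly R \o T)
  else (if cd.2 then X else Y).
have injF cd : injective (F cd).
  case: cd => [[] []] /=; rewrite /F /= -?eT';
    try exact/tnth3_inj/triangle_uniq.
    exact/tnth3_inj/x_axis_triple_uniq.
  by apply: inj_comp (can_inj (@swapK R)) _; exact/tnth3_inj/x_axis_triple_uniq.
(* Distinguishing points: the triangles have no vertex of abscissa 0, unlike [X] and [Y]; [Y] has a
   nonzero ordinate, unlike [X]; and the apex abscissa of [T] does not occur in its mirror image. *)
have rangeF cd cd' : range (F cd) = range (F cd') -> cd = cd'.
  have nz d j : (F (true, d) j).1 != 0.
    by case: d; rewrite /F /= -?eT'; elim/forall_ord3: j;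
      rewrite /T /triangle (tnth_nth (0, 0)) /= ?inordK //=; lra.
  have z d : (F (false, d) 1).1 = 0 by case: d.
  have x2 j : (X j).2 = 0.
    by elim/forall_ord3: j;
      rewrite /X /x_axis_triple (tnth_nth (0, 0)) /= ?inordK.
  have y2 : (Y 0).2 != 0 by rewrite /Y /= oppr_eq0 gt_eqF.
  have t0 j : (triangle (- h) c j).1 != (T 0).1.
    by elim/forall_ord3: j;
      rewrite /T /triangle !(tnth_nth (0, 0)) /= ?inordK //=; lra.
  move=> er'; have mem i : exists j, F cd' j = F cd i.
    by have [j _ ej] : range (F cd') (F cd i) by [rewrite -er'; exists i];
      exists j.
  have mem' i : exists j, F cd j = F cd' i.
    by have [j _ ej] : range (F cd) (F cd' i) by [rewrite er'; exists i];
      exists j.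
  case: cd cd' mem mem' {er'} => [[] d] [[] d'] mem mem'.
  - case: d d' mem mem' => [] [] // mem mem'.
      by have [j ej] := mem 0; have := t0 j; rewrite eT' [(_ \o _) j]ej eqxx.
    by have [j ej] := mem' 0; have := t0 j; rewrite eT' [(_ \o _) j]ej eqxx.
  - by have [j ej] := mem' 1; have := nz d j; rewrite ej z eqxx.
  - by have [j ej] := mem 1; have := nz d' j; rewrite ej z eqxx.
  - case: d d' mem mem' => [] [] // mem mem'.
      by have [j ej] := mem' 0; have := y2; rewrite -[Y 0]ej x2 eqxx.
    by have [j ej] := mem 0; have := y2; rewrite -[Y 0]ej x2 eqxx.
have cardF : \bigcup_cd labellings (F cd) #= `I_(4 * 3`!).
  by have := card_labellings injF rangeF; rewrite card_prod card_bool.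
have cardT : \bigcup_d labellings (F (true, d)) #= `I_(2 * 3`!).
  have := @card_labellings R 3 _ (fun d => F (true, d)); rewrite card_bool;
    apply.
    by move=> d; exact: injF.
  by move=> d d' /rangeF[].
have card1 cd : labellings (F cd) #= `I_(3`!).
  have -> : labellings (F cd) = \bigcup_(_ : unit) labellings (F cd).
    by apply/seteqP; split=> [p Lp|p [_ _ //]]; exists tt.
  have := @card_labellings R 3 _ (fun _ : unit => F cd);
    rewrite card_unit mul1n.
  by apply=> [_|[] []]; first exact: injF.
have bigT : \bigcup_d labellings (F (true, d)) = labellings T `|` labellings (@refly R \o T).
  apply/seteqP; split=> [p [[] _ Lp]|p [Lp|Lp]];
    [by left|by right|by exists true|by exists false].
split=> //.
- split=> //; rewrite SolE SolX SolY SolT.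
  suff <- : \bigcup_cd labellings (F cd) =
      labellings X `|` labellings Y `|` (labellings T `|` labellings (@refly R \o T)) by [].
  apply/seteqP; split=> [p [[[] []] _ Lp]|p [[]|[]] Lp].
  + by right; left.
  + by right; right.
  + by left; left.
  + by left; right.
  + by exists (false, true).
  + by exists (false, false).
  + by exists (true, true).
  + by exists (true, false).
- by rewrite SolX; exact: (card1 (false, true)).
- by rewrite SolY; exact: (card1 (false, false)).
- by split; [rewrite SolT -bigT|exists T].
Qed.
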